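(* Let $(n_k)_{k\in\mathbb{N}}$ be a sequence of natural numbers with nested spectrums which has unbounded variation, i.e. $\sup_k V(n_k)=\infty$. Then there exists a function $f\in L[0,1)$ such that $\sup_{k\in\mathbb{N}}|S_{n_k}(f)(x)|=\infty$ for every $x\in[0,1)$.
   Context: $\mathbb{N}_0$ is the set of non-negative integers. Let $r:\mathbb{R}\to\mathbb{R}$ be the $1$-periodic function with $r(x)=1$ for $x\in[0,1/2)$ and $r(x)=-1$ for $x\in[1/2,1)$, and let $r_n(x)=r(2^nx)$ $(n\in\mathbb{N}_0,\ x\in[0,1))$ be the Rademacher functions. For $n\in\mathbb{N}_0$ let $\varepsilon_j(n)\in\{0,1\}$ $(j\in\mathbb{N}_0)$ be its binary coefficients, $n=\sum_{j=0}^\infty\varepsilon_j(n)2^j$. The Walsh system is $w_n(x)=\prod_{j=0}^\infty r_j(x)^{\varepsilon_j(n)}$ $(n\in\mathbb{N}_0,\ x\in[0,1))$. For $f\in L[0,1)$ (Lebesgue integrable), the partial Walsh-Fourier sums are $S_n(f)=\sum_{k=0}^{n-1}\widehat f(k)w_k$, where $\widehat f(k)=\int_{[0,1)}fw_k$. The variation of $n\in\mathbb{N}_0$ is $V(n)=\varepsilon_0(n)+\sum_{j=1}^\infty|\varepsilon_j(n)-\varepsilon_{j-1}(n)|$. A sequence $(n_k)$ has bounded variation if $\sup_kV(n_k)<\infty$, and unbounded variation otherwise. The spectrum of $n$ is $\mathrm{Sp}(n)=\{j\in\mathbb{N}_0:\varepsilon_j(n)=1\}$. A sequence with nested spectrums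 is an increasing sequence of natural numbers $(n_k)_{k\in\mathbb{N}}$ (natural numbers are positive integers) such that $\mathrm{Sp}(n_{k+1})\cap[0,\max\mathrm{Sp}(n_k)]=\mathrm{Sp}(n_k)$ for every $k\in\mathbb{N}$. *)

(* Defs.v *)
From HB Require Import structures.
From mathcomp Require Import all_boot all_order all_algebra.
From mathcomp Require Import all_classical all_reals all_analysis.

Set Implicit Arguments.
Unset Strict Implicit.
Unset Printing Implicit Defensive.

Import Order.TTheory GRing.Theory Num.Theory.
Import numFieldNormedType.Exports.

Local Open Scope classical_set_scope.
Local Open Scope ring_scope.

Section binary.
Local Open Scope nat_scope.

Definition binary_coef (j n : nat) : nat := odd (n %/ 2 ^ j).

Lemma binary_coef_small (j n : nat) : n <= j -> binary_coef j n = 0.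
Proof.
move=> nj; rewrite /binary_coef divn_small //.
by apply: (leq_ltn_trans nj); exact: ltn_expl.
Qed.

Lemma binary_expansion (n N : nat) : n <= N ->
  n = \sum_(0 <= j < N) binary_coef j n * 2 ^ j.
Proof.
move=> nN; have step (M : nat) :
    n = \sum_(0 <= j < M) binary_coef j n * 2 ^ j + n %/ 2 ^ M * 2 ^ M.
  elim: M => [|M IH]; first by rewrite big_geq // expn0 divn1 muln1.
  rewrite big_nat_recr //= [LHS]IH -addnA; congr addn.
  rewrite expnSr divnMA divn2 [2 ^ M * 2]mulnC mulnA -mulnDl muln2.
  by rewrite /binary_coef odd_double_half.
rewrite [LHS](step N) divn_small ?mul0n ?addn0 //.
by apply: (leq_ltn_trans nN); exact: ltn_expl.
Qed.

(* The terms with j > n of the infinite sum vanish (see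
   [walsh_variationE]); the term j = n does not when n = 1. *)
Definition walsh_variation (n : nat) : nat :=
  binary_coef 0 n +
  \sum_(1 <= j < n.+1) absz ((binary_coef j n)%:Z - (binary_coef j.-1 n)%:Z)%R.

Lemma walsh_variationE (n N : nat) : n < N ->
  walsh_variation n = binary_coef 0 n +
  \sum_(1 <= j < N) absz ((binary_coef j n)%:Z - (binary_coef j.-1 n)%:Z)%R.
Proof.
move=> nN; rewrite /walsh_variation [in RHS](@big_cat_nat _ _ _ n.+1) //=.
rewrite [X in _ = _ + (_ + X)]big1_seq ?addn0 // => j.
rewrite andTb mem_index_iota => /andP[nj _].
by rewrite !binary_coef_small //; [case: j nj | exact: ltnW].
Qed.

Definition spectrum (n : nat) : set nat := [set j | binary_coef j n = 1].

(* Maximum of [spectrum n] for n > 0; all elements of the spectrum are < n. *)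
Definition max_spectrum (n : nat) : nat :=
  \max_(0 <= j < n | binary_coef j n == 1) j.

Definition nested_spectrums (n_ : nat -> nat) : Prop :=
  [/\ forall k, 0 < n_ k,
      forall k, n_ k < n_ k.+1 &
      forall k, spectrum (n_ k.+1) `&` [set j | j <= max_spectrum (n_ k)] =
                spectrum (n_ k)].

End binary.

Section walsh.
Variable R : realType.
Implicit Types (f : R -> R) (x : R) (n : nat).

Definition rademacher0 x : R :=
  if x - (Num.floor x)%:~R < 2^-1 then 1 else -1.

Definition rademacher n x : R := rademacher0 (2 ^+ n * x).

(* The factors with j >= n of the infinite product are 1 (see [walshE]). *)
Definition walsh n x : R :=
  \prod_(0 <= j < n) rademacher j x ^+ binary_coef j n.

Lemma walshE n (N : nat) x : (n <= N)%N ->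
  walsh n x = \prod_(0 <= j < N) rademacher j x ^+ binary_coef j n.
Proof.
move=> nN; rewrite /walsh [in RHS](@big_cat_nat _ _ _ n) //=.
rewrite [X in _ = _ * X]big1_seq ?mulr1 // => j.
by rewrite andTb mem_index_iota => /andP[nj _]; rewrite binary_coef_small.
Qed.

Definition walsh_coef f n : R :=
  \int[lebesgue_measure]_(x in `[0, 1[) (f x * walsh n x).

Definition walsh_partial_sum n f x : R :=
  \sum_(0 <= k < n) walsh_coef f k * walsh k x.

End walsh.

(* Main.v *)
(* The Dirichlet kernel D_n, multiplied by w_n, takes at two points that first
   differ in their binary digit number s the value
     h_s = sum_(j < s) e_j 2^j - e_s 2^s     (e_j the binary digits of n),
   and |h_s| >= 2^(s-1) whenever e_s <> e_(s-1).  For a sequence with nested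
   spectrums the e_j do not depend on k, so |h_s| does not either.

   Put one point mass 2^-M in each dyadic interval of rank M.  Seen from x, the
   masses contribute to w_(n_k)(x) S_(n_k)(x) the numbers 2^-M w_(n_k)(y) h_s,
   where y is the position of the mass.  The digit of y number max Sp(n_k)
   enters w_(n_k) but none of w_(n_l), l < k, hence the signs w_(n_k)(y) can be
   prescribed for finitely many k and all y: for each interval I some k aligns
   all masses outside I, giving a sum of size about V(n_k)/4 for every x in I.
   The mass inside I could cancel it, so two indices are reserved for I, with
   opposite signs outside I and the same sign inside; one of them is harmless.

   Replacing the masses by narrow spikes gives Walsh polynomials P >= 0 of
   integral 1 with sup_k |S_(n_k) P| >= A everywhere, and a gliding hump
   sum_i delta_i P_i diverges at every point. *)
Require Import Defs.
From mathcomp Require Import all_boot all_order all_algebra.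
From mathcomp Require Import all_classical all_reals all_analysis.
From mathcomp Require Import measurable_realfun.
From mathcomp Require Import zify ring lra.
Import Order.TTheory GRing.Theory Num.Theory.
Import numFieldNormedType.Exports.
Local Open Scope classical_set_scope.
Local Open Scope ring_scope.

Set Implicit Arguments.
Unset Strict Implicit.
Unset Printing Implicit Defensive.

(** * Binary digits and nested spectrums *)

Section binary_expansions.
Local Open Scope nat_scope.

Lemma binary_coef0 n : binary_coef 0 n = odd n.
Proof. by rewrite /binary_coef expn0 divn1. Qed.

Lemma binary_coefS j n : binary_coef j.+1 n = binary_coef j n./2.
Proof. by rewrite /binary_coef expnS divnMA divn2. Qed.

Lemma binary_coef_le1 j n : binary_coef j n <= 1.
Proof. by rewrite /binary_coef leq_b1. Qed.

Lemma binary_coef_eq0 j n : n < 2 ^ j -> binary_coef j n = 0.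
Proof. by move=> nj; rewrite /binary_coef divn_small. Qed.

Lemma eq_binary_coef m n : binary_coef^~ m =1 binary_coef^~ n -> m = n.
Proof.
move=> mn; rewrite (@binary_expansion m (m + n)) ?leq_addr//.
rewrite [RHS](@binary_expansion n (m + n)) ?leq_addl//.
by apply: eq_bigr => j _; rewrite mn.
Qed.

Lemma divn_trunc_log n : 0 < n -> n %/ 2 ^ trunc_log 2 n = 1.
Proof.
move=> n0; apply/eqP; rewrite eqn_leq -ltnS ltn_divLR ?expn_gt0//.
by rewrite leq_divRL ?expn_gt0// mul1n -expnS trunc_log_ltn// trunc_logP.
Qed.

Lemma max_spectrumE n : 0 < n -> max_spectrum n = trunc_log 2 n.
Proof.
move=> n0; have tn := @trunc_logP 2 n isT n0.
apply/eqP; rewrite eqn_leq; apply/andP; split.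
  apply/bigmax_leqP_seq => j _ /eqP jn; apply: trunc_log_max => //.
  by rewrite leqNgt; apply/negP => /binary_coef_eq0; rewrite jn.
rewrite /max_spectrum big_mkord.
have tltn : trunc_log 2 n < n by apply: leq_trans tn; exact: ltn_expl.
apply: (@leq_bigmax_cond _ _ (fun i : 'I_n => i : nat) (Ordinal tltn)).
by rewrite /= /binary_coef divn_trunc_log.
Qed.

Lemma binary_coef_max_spectrum n : 0 < n -> binary_coef (max_spectrum n) n = 1.
Proof.
by move=> n0; rewrite max_spectrumE// /binary_coef divn_trunc_log.
Qed.

Lemma ltn_max_spectrum n : 0 < n -> n < 2 ^ (max_spectrum n).+1.
Proof. by move=> n0; rewrite max_spectrumE//; exact: trunc_log_ltn. Qed.

Lemma binary_coef_gt_max_spectrum n j : 0 < n -> max_spectrum n < j ->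
  binary_coef j n = 0.
Proof.
move=> n0 nj; apply: binary_coef_eq0.
by apply: leq_trans (ltn_max_spectrum n0) _; rewrite leq_exp2l.
Qed.

(* The boundary term j = max_spectrum n + 1 contributes at most 1. *)
Lemma walsh_variation_le n : 0 < n ->
  walsh_variation n <=
  (\sum_(1 <= j < (max_spectrum n).+1) (binary_coef j n != binary_coef j.-1 n))
  + 2.
Proof.
move=> n0; set m := max_spectrum n.
have mn : m < n.
  rewrite /m max_spectrumE//; apply: leq_trans (@trunc_logP 2 n isT n0).
  exact: ltn_expl.
have dist j : absz ((binary_coef j n)%:Z - (binary_coef j.-1 n)%:Z)%R =
    (binary_coef j n != binary_coef j.-1 n).
  by rewrite /binary_coef; case: odd; case: odd.
rewrite /walsh_variation (@big_cat_nat _ _ _ m.+1) //=; last exact: leqW.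
rewrite (eq_bigr (fun j => (binary_coef j n != binary_coef j.-1 n) : nat)) //.
rewrite [X in (_ + (_ + X) <= _)%N]big_ltn// [X in (_ + (_ + (_ + X)) <= _)%N]big1_seq => [|j].
  by have := binary_coef_le1 0 n; rewrite dist; case: (_ != _); lia.
rewrite andTb mem_index_iota => /andP[mj _].
by rewrite !binary_coef_gt_max_spectrum// -/m; lia.
Qed.

End binary_expansions.

(** * Nested spectrums and their common digit sequence *)

Section nested.
Local Open Scope nat_scope.
Variable n_ : nat -> nat.
Hypothesis nested_n : nested_spectrums n_.

Let top k := max_spectrum (n_ k).

Lemma nested_binary_coef k j : j <= top k ->
  binary_coef j (n_ k.+1) = binary_coef j (n_ k).
Proof.
case: nested_n => _ _ /(_ k) /seteqP[sub sup] jk.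
have coefE n : binary_coef j n = (binary_coef j n == 1).
  by rewrite /binary_coef; case: odd.
rewrite coefE [RHS]coefE; congr nat_of_bool; apply/eqP/eqP => h.
- by apply: sub; split.
- by have [] := sup _ h.
Qed.

(** If the top digit did not move up from [n_ k] to [n_ k.+1], nesting would make all digits of the
    two numbers agree, against [n_ k < n_ k.+1]. *)
Lemma nested_max_spectrum_lt : {homo top : k l / k < l}.
Proof.
case: nested_n => n0 ni _.
apply: homo_ltn; first exact: ltn_trans.
move=> k; rewrite ltnNge; apply/negP => le_top; have := ni k.
suff -> : n_ k.+1 = n_ k by rewrite ltnn.
apply: eq_binary_coef => j /=; have [jk|kj] := leqP j (top k).
  exact: nested_binary_coef.
by rewrite !binary_coef_gt_max_spectrum// (leq_ltn_trans le_top).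
Qed.

Lemma nested_leq_max_spectrum k : k <= top k.
Proof.
elim: k => // k IH; apply: leq_ltn_trans IH _.
exact: nested_max_spectrum_lt.
Qed.

(** Digit [j] is final as soon as [j <= top k], and [k = j] is always late enough, so the diagonal
    reads off the common digit sequence of all the [n_ k]. *)
Definition limit_bits j := binary_coef j (n_ j).

Lemma nested_limit_bits k j : j <= top k -> binary_coef j (n_ k) = limit_bits j.
Proof.
have stable l l' : l <= l' -> j <= top l ->
    binary_coef j (n_ l') = binary_coef j (n_ l).
  move=> + jl; elim: l' => [|l' IH]; first by rewrite leqn0 => /eqP->.
  rewrite leq_eqVlt => /predU1P[->//|]; rewrite ltnS => ll'.
  rewrite nested_binary_coef ?IH// (leq_trans jl)//.
  by move: ll'; rewrite leq_eqVlt => /predU1P[->//|/nested_max_spectrum_lt/ltnW].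
move=> jk; have [kj|/ltnW jk'] := leqP k j; first by rewrite /limit_bits (stable k).
by rewrite /limit_bits -(stable j k jk')// nested_leq_max_spectrum.
Qed.

Lemma limit_bits_le1 j : limit_bits j <= 1.
Proof. exact: binary_coef_le1. Qed.

End nested.

(** * The Dirichlet kernel *)

Section signs.
Variable R : realType.
Implicit Types (a : nat -> R) (b : nat -> bool) (n : nat).

(** The Walsh function as a function of the Rademacher values [a j] of a point. Pointwise products
    of sign sequences stand for dyadic sums of points. *)
Definition walsh_sign n a : R := \prod_(0 <= j < n) a j ^+ binary_coef j n.

Lemma walsh_signE n N a : (n < 2 ^ N)%N ->
  walsh_sign n a = \prod_(0 <= j < N) a j ^+ binary_coef j n.
Proof.
move=> nN; pose F M := \prod_(0 <= j < M) a j ^+ binary_coef j n.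
have ext M M' : (n < 2 ^ M)%N -> (M <= M')%N -> F M' = F M.
  move=> nM MM'; rewrite /F (@big_cat_nat _ _ _ M) //=.
  rewrite [X in _ * X]big1_seq ?mulr1// => j.
  rewrite andTb mem_index_iota => /andP[Mj _]; rewrite binary_coef_eq0//.
  by apply: leq_trans nM _; rewrite leq_exp2l.
have nn : (n < 2 ^ n)%N by exact: ltn_expl.
rewrite -/(F N) /walsh_sign -/(F n) -(ext N (N + n)%N) ?leq_addr//.
by rewrite -(ext n (N + n)%N) ?leq_addl.
Qed.

Lemma walsh_sign_half n a :
  walsh_sign n a = a 0%N ^+ odd n * walsh_sign n./2 (a \o S).
Proof.
have nn : (n < 2 ^ n.+1)%N by apply: ltnW; exact: ltn_expl.
have n2 : (n./2 < 2 ^ n)%N.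
  by apply: leq_ltn_trans (ltn_expl _ _) => //; lia.
rewrite (walsh_signE _ nn) (walsh_signE _ n2) big_nat_recl// binary_coef0.
by congr (_ * _); apply: eq_bigr => j _; rewrite binary_coefS.
Qed.

Lemma walsh_signM n a a' :
  walsh_sign n (fun j => a j * a' j) = walsh_sign n a * walsh_sign n a'.
Proof. by rewrite /walsh_sign -big_split; apply: eq_bigr => j _; rewrite exprMn. Qed.

Lemma eq_walsh_sign n N a a' : (n < 2 ^ N)%N -> (forall j, (j < N)%N -> a j = a' j) ->
  walsh_sign n a = walsh_sign n a'.
Proof.
move=> nN aa'; rewrite !(walsh_signE _ nN); apply: eq_big_nat => j /andP[_ jN].
by rewrite aa'.
Qed.

Lemma walsh_sign_sqr n a : (forall j, a j ^+ 2 = 1) -> walsh_sign n a ^+ 2 = 1.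
Proof.
move=> a2; rewrite expr2 -walsh_signM /walsh_sign big1// => j _.
by rewrite -expr2 a2 expr1n.
Qed.

Lemma walsh_sign_norm n a : (forall j, a j ^+ 2 = 1) -> `|walsh_sign n a| = 1.
Proof.
move=> /(walsh_sign_sqr n)/eqP; rewrite sqrf_eq1 => /orP[]/eqP->.
  exact: normr1.
by rewrite normrN1.
Qed.

Definition dirichlet_sign n a : R := \sum_(0 <= k < n) walsh_sign k a.

(** The terms [2q] and [2q+1] add up to [1 + a 0] times the [q]-th Walsh sign of the shifted
    sequence; for odd [n] the last term is left unpaired. *)
Lemma dirichlet_sign_half n a : dirichlet_sign n a =
  (1 + a 0%N) * dirichlet_sign n./2 (a \o S) + (odd n)%:R * walsh_sign n./2 (a \o S).
Proof.
have dbl q : dirichlet_sign q.*2 a = (1 + a 0%N) * dirichlet_sign q (a \o S).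
  elim: q => [|q IH]; first by rewrite /dirichlet_sign !big_geq// mulr0.
  rewrite doubleS /dirichlet_sign big_nat_recr//= big_nat_recr//=.
  rewrite -/(dirichlet_sign _ _) IH [in RHS]big_nat_recr//= mulrDr.
  rewrite -/(dirichlet_sign q _) -addrA; congr (_ + _).
  rewrite walsh_sign_half (walsh_sign_half q.*2.+1) /= odd_double/= doubleK.
  by rewrite uphalf_double expr0 expr1 mul1r mulrDl mul1r.
rewrite -{1}(odd_double_half n); case: (odd n); last by rewrite add0n dbl mul0r addr0.
rewrite add1n /dirichlet_sign big_nat_recr//= -/(dirichlet_sign _ _) dbl mul1r.
by rewrite (walsh_sign_half n./2.*2) odd_double doubleK expr0 mul1r.
Qed.

Lemma dirichlet_sign1 n N a : (n < 2 ^ N)%N -> (forall j, (j < N)%N -> a j = 1) ->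
  dirichlet_sign n a = n%:R.
Proof.
move=> nN a1; rewrite /dirichlet_sign (eq_big_nat _ _ (F2 := fun=> 1)).
  by rewrite big_const_nat subn0 iter_addr addr0.
move=> k /andP[_ kn]; rewrite (@walsh_signE _ N) ?(ltn_trans kn)//.
by rewrite big1_seq// => j /andP[_]; rewrite mem_index_iota => /andP[_ /a1->]; rewrite expr1n.
Qed.

Definition kernel_height (e : nat -> nat) s : R :=
  \sum_(0 <= j < s) (e j)%:R * 2 ^+ j - (e s)%:R * 2 ^+ s.

Lemma eq_kernel_height e e' s : (forall j, (j <= s)%N -> e j = e' j) ->
  kernel_height e s = kernel_height e' s.
Proof.
move=> ee'; rewrite /kernel_height (ee' s)//; congr (_ - _).
by apply: eq_big_nat => j /andP[_ /ltnW/ee'->].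
Qed.

(* Multiplying the Dirichlet kernel by w_n leaves a quantity that only
   involves the bits of n up to the first place where the two points differ. *)
Lemma walsh_sign_dirichlet n a s : (forall j, a j ^+ 2 = 1) ->
  (forall j, (j < s)%N -> a j = 1) -> a s = -1 ->
  walsh_sign n a * dirichlet_sign n a = kernel_height (binary_coef^~ n) s.
Proof.
elim: s n a => [|s IH] n a a2 a1 as1; rewrite dirichlet_sign_half walsh_sign_half.
  rewrite as1 subrr mul0r add0r /kernel_height big_geq// binary_coef0 add0r.
  rewrite expr0 mulr1; case: (odd n); last by rewrite !mul0r mulr0 oppr0.
  by rewrite expr1 mulN1r mul1r mulNr -expr2 walsh_sign_sqr// => j; exact: a2.
have IH' := IH n./2 (a \o S) (fun j => a2 j.+1) (fun j => a1 j.+1) as1.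
rewrite a1// expr1n mul1r mulrDr mulrCA IH' mulrCA -expr2 walsh_sign_sqr; last first.
  by move=> j; exact: a2.
rewrite /kernel_height big_nat_recl// binary_coef0 binary_coefS.
under [in RHS]eq_bigr => j _ do rewrite binary_coefS exprS mulrCA.
by rewrite -mulr_sumr !exprS expr0; ring.
Qed.

(** The digits below [s] contribute some [T] between 0 and [2 ^+ s]. With digits 1, 0 at places [s],
    [s.+1] the height is [T + 2 ^+ s]; with digits 0, 1 it is [T - 2 ^+ s.+1], at most
    [- 2 ^+ s]. *)
Lemma kernel_height_ge e s : (forall j, (e j <= 1)%N) -> e s.+1 != e s ->
  2 ^+ s <= `|kernel_height e s.+1|.
Proof.
move=> e1 es; set T := \sum_(0 <= j < s) (e j)%:R * (2 : R) ^+ j.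
have T0 : 0 <= T by apply: sumr_ge0 => j _; rewrite mulr_ge0// exprn_ge0.
have T2 : T <= 2 ^+ s.
  have -> : 2 ^+ s = \sum_(0 <= j < s) (2 : R) ^+ j + 1.
    elim: (s) => [|t IH]; first by rewrite big_geq// add0r expr0.
    by rewrite big_nat_recr//= exprS {1}IH; lra.
  apply: ler_wpDr => //; apply: ler_sum => j _.
  by rewrite ler_piMl ?exprn_ge0// lern1.
rewrite /kernel_height big_nat_recr//= -/T exprS.
have s0 : 0 <= (2 : R) ^+ s by rewrite exprn_ge0.
move: es (e1 s) (e1 s.+1); case: (e s) => [|[|//]]; case: (e s.+1) => [|[|//]]// _ _ _.
- by rewrite ler_normr; apply/orP; right; lra.
- by rewrite ler_normr; apply/orP; left; lra.
Qed.

End signs.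

(** * Aligning the signs of the point masses *)

Section first_split.
Variable M : nat.
Local Notation T := {ffun 'I_M -> bool}.

Definition splits_at (i i' : T) (s : 'I_M) :=
  (i s != i' s) && [forall j : 'I_M, (j < s)%N ==> (i j == i' j)].

Lemma splits_at_unique i i' s s' :
  splits_at i i' s -> splits_at i i' s' -> s' = s.
Proof.
move=> /andP[ns /forallP ls] /andP[ns' /forallP ls'].
apply: ord_inj; case: (ltngtP s' s) => [lt|lt|//].
- by move: (ls s'); rewrite lt (negbTE ns').
- by move: (ls' s); rewrite lt (negbTE ns).
Qed.

Lemma splits_at_exists i i' : i != i' -> exists s, splits_at i i' s.
Proof.
move=> ii'; have [s0 ds0] : exists s, i s != i' s.
  apply/existsP; apply: contraNT ii'; rewrite negb_exists => /forallP h.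
  by apply/eqP/ffunP => j; apply/eqP; have := h j; rewrite negbK.
case: (@arg_minnP _ s0 (fun s => i s != i' s) val ds0) => s ds smin.
exists s; rewrite /splits_at ds; apply/forallP => j; apply/implyP => js.
by apply: contraTT js => /smin; rewrite -leqNgt.
Qed.

Lemma splits_at_refl i s : splits_at i i s = false.
Proof. by rewrite /splits_at eqxx. Qed.

(** Digits before [s] are forced, digit [s] is flipped, and the remaining [M - s.+1] digits are
    free; [F] lists the admissible values digit by digit. *)
Lemma card_splits_at i (s : 'I_M) : #|splits_at i ^~ s| = (2 ^ (M - s.+1))%N.
Proof.
pose F (j : 'I_M) : {pred bool} :=
  if (j < s)%N then pred1 (i j) else if j == s then pred1 (~~ i j) else predT.
have -> : #|splits_at i ^~ s| = #|family F|.
  apply: eq_card => i'; rewrite unfold_in /splits_at.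
  apply/andP/familyP => [[ns /forallP ls] j|h].
  - rewrite /F; case: ltnP => [js|sj]; first by move: (ls j); rewrite js /= eq_sym.
    case: eqP => // ->; rewrite inE; by case: (i s) (i' s) ns => [] [].
  - split; last first.
      apply/forallP => j; apply/implyP => js; have := h j.
      by rewrite /F js inE eq_sym.
    have := h s; rewrite /F ltnn eqxx inE; by case: (i s) (i' s) => [] [].
rewrite card_family foldrE big_map -[enum _]/(enum 'I_M) big_enum/=.
rewrite (eq_bigr (fun j : 'I_M => if (j <= s)%N then 1%N else 2)) => [|j _]; last first.
  rewrite /F; case: ltngtP => [js|sj|/val_inj->]; rewrite ?card1 ?eqxx ?card1//.
  by rewrite -val_eqE /= gtn_eqF//; exact: card_bool.
rewrite -(big_mkord xpredT (fun j => if (j <= s)%N then 1%N else 2)).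
rewrite (@big_cat_nat _ _ _ s.+1) //= big_nat.
rewrite (eq_bigr (fun=> 1%N)) => [|j /andP[_]]; last by rewrite ltnS => ->.
rewrite big1_eq// mul1n big_nat (eq_bigr (fun=> 2)) => [|j /andP[]]; last first.
  by rewrite leqNgt => /negbTE; rewrite ltnS => ->.
by rewrite -big_nat prod_nat_const_nat.
Qed.

(** Grouping the other cells by the first digit where they leave [i] gives a total that does not
    depend on [i]. *)
Lemma sum_splits_at (R : realType) (i : T) (f : nat -> R) :
  \sum_(i' | i' != i) \sum_(s : 'I_M | splits_at i i' s) f s =
  \sum_(s < M) f s * 2 ^+ (M - s.+1).
Proof.
transitivity (\sum_i' \sum_(s : 'I_M | splits_at i i' s) f s).
  rewrite [RHS](bigD1 i)//= [X in _ = X + _]big1 ?add0r// => s.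
  by rewrite splits_at_refl.
rewrite (exchange_big_dep xpredT)//=; apply: eq_bigr => s _.
by rewrite sumr_const card_splits_at -[LHS]mulr_natr natrX.
Qed.

End first_split.

(** * Prescribing Walsh signs along the sequence *)

Section hump.
Variable R : realType.
Variable n_ : nat -> nat.
Hypothesis nested_n : nested_spectrums n_.

Let top k := max_spectrum (n_ k).

Definition bit_signs (b : nat -> bool) j : R := (-1) ^+ b j.

Lemma bit_signs_sqr b j : bit_signs b j ^+ 2 = 1.
Proof. exact: sqrr_sign. Qed.

Let ltn_top k : (n_ k < 2 ^ (top k).+1)%N.
Proof. by apply: ltn_max_spectrum; case: nested_n. Qed.

(* n_k is the first member of the sequence whose Walsh function depends on the
   binary digit number max_spectrum (n_ k), so that digit fixes the sign. *)
Lemma exists_bits_walsh_sign (b0 : nat -> bool) k0 K (t : nat -> bool) :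
  exists b : nat -> bool, (forall j, (j < max_spectrum (n_ k0))%N -> b j = b0 j) /\
    forall k, (k < K)%N -> walsh_sign (n_ (k0 + k)) (bit_signs b) = (-1) ^+ t k.
Proof.
elim: K => [|K [b [bb0 bt]]]; first by exists b0.
set m := top (k0 + K).
pose p := \prod_(0 <= j < m) bit_signs b j ^+ binary_coef j (n_ (k0 + K)).
have p1 : p ^+ 2 = 1.
  rewrite /p -prodrXl big1_seq// => j _.
  by rewrite -exprM mulnC exprM bit_signs_sqr expr1n.
(* Digit [m] enters the Walsh sign to the power 1; it is chosen to cancel the sign [p] of the lower
   digits and to leave [(-1) ^+ t K]. *)
pose b' j := if j == m then (p == -1) (+) t K else b j.
have b'b j : (j < m)%N -> b' j = b j by rewrite /b' => /ltn_eqF->.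
exists b'; split=> [j jk|k].
  rewrite b'b ?bb0// (leq_trans jk)// /m.
  case: (K) => [|K']; first by rewrite addn0.
  by apply/ltnW/(nested_max_spectrum_lt nested_n); lia.
rewrite ltnS leq_eqVlt => /predU1P[->|kK].
  rewrite (walsh_signE _ (ltn_top _)) big_nat_recr//= -/m.
  rewrite [X in _ ^+ X]binary_coef_max_spectrum; last by case: nested_n.
  rewrite expr1 {2}/bit_signs {2}/b' eqxx signr_addb mulrA.
  rewrite -[RHS]mul1r; congr (_ * _).
  transitivity (p * (-1) ^+ (p == -1)).
    congr (_ * _); apply: eq_big_nat => j /andP[_ jm].
    by rewrite /bit_signs b'b.
  move/eqP: p1; rewrite sqrf_eq1 => /orP[]/eqP->.
    have /negbTE-> : (1 : R) != -1 by apply/eqP; lra.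
    by rewrite mulr1.
  by rewrite eqxx expr1 mulrNN mulr1.
rewrite -bt//; apply: (eq_walsh_sign (ltn_top _)) => j jk.
rewrite /bit_signs b'b// (leq_trans jk)//.
by apply: (nested_max_spectrum_lt nested_n); lia.
Qed.

Lemma nested_kernel_height (a : nat -> R) s k : (forall j, a j ^+ 2 = 1) ->
  (forall j, (j < s)%N -> a j = 1) -> a s = -1 -> (s <= top k)%N ->
  walsh_sign (n_ k) a * dirichlet_sign (n_ k) a = kernel_height R (limit_bits n_) s.
Proof.
move=> a2 a1 as1 sk; rewrite (walsh_sign_dirichlet _ a2 a1 as1).
apply: eq_kernel_height => j js /=.
by rewrite nested_limit_bits// (leq_trans js).
Qed.

(** Controls the mass lying in the same cell as the point. If no sign up to [top k] is -1, the value
    at [k] is [n_ k] itself; otherwise the first -1 is at a place visible to both indices, and both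
    values equal the same height. *)
Lemma nested_kernel_ge0_or_eq (a : nat -> R) k k' : (forall j, a j ^+ 2 = 1) -> (k <= k')%N ->
  0 <= walsh_sign (n_ k) a * dirichlet_sign (n_ k) a \/
  walsh_sign (n_ k') a * dirichlet_sign (n_ k') a =
  walsh_sign (n_ k) a * dirichlet_sign (n_ k) a.
Proof.
move=> a2 kk'.
have [/existsP[s0 as0]|] := boolP [exists s : 'I_(top k).+1, a s != 1]; last first.
  rewrite negb_exists => /forallP a1; left.
  have a1' j : (j < (top k).+1)%N -> a j = 1.
    by move=> jk; have := a1 (Ordinal jk); rewrite negbK => /eqP.
  rewrite (dirichlet_sign1 (ltn_top k) a1').
  rewrite (eq_walsh_sign (ltn_top k) (a' := fun=> 1) a1') /walsh_sign.
  by rewrite big1 ?mul1r// => j _; rewrite expr1n.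
right; case: (@arg_minnP _ s0 (fun s => a s != 1) val as0) => s as1 smin.
have a1 j : (j < s)%N -> a j = 1.
  move=> js; have jk : (j < (top k).+1)%N by exact: ltn_trans js _.
  apply/eqP; apply: contraTT js => /(smin (Ordinal jk)); by rewrite -leqNgt.
have asN : a s = -1.
  by move/eqP: (a2 s); rewrite sqrf_eq1 (negbTE as1) => /eqP.
have sk : (s <= top k)%N by rewrite -ltnS.
rewrite !(@nested_kernel_height a s)// (leq_trans sk)//.
move: kk'; rewrite leq_eqVlt => /predU1P[->//|].
by move=> /(nested_max_spectrum_lt nested_n)/ltnW.
Qed.

End hump.

(** * Large kernel averages over point masses *)

Section discrete_hump.
Variable R : realType.
Variable n_ : nat -> nat.
Hypothesis nested_n : nested_spectrums n_.

Let top k := max_spectrum (n_ k).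
Let height s : R := kernel_height R (limit_bits n_) s.

(** A digit change between [s] and [s.+1] forces [2 ^+ s <= |height s.+1|]; against the weight
    [2 ^+ (M - s.+2)] and the factors [2 ^- M] and 4, this contributes at least 1. *)
Lemma sum_height_ge k : 
  (\sum_(1 <= j < (top k).+1)
     (binary_coef j (n_ k) != binary_coef j.-1 (n_ k)))%:R <=
  4 * (2 ^- (top k).+1 * \sum_(s < (top k).+1) `|height s| * 2 ^+ ((top k).+1 - s.+1)).
Proof.
set M := (top k).+1.
have h0 s : 0 <= 4 * (2 ^- M * (`|height s| * 2 ^+ (M - s.+1))).
  by rewrite !mulr_ge0// ?invr_ge0 exprn_ge0.
rewrite 2!mulr_sumr -(big_mkord xpredT (fun s => 4 * (2 ^- M * (`|height s| * 2 ^+ (M - s.+1))))).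
rewrite /M [leRHS]big_ltn// -/M natr_sum ler_wpDl// !big_add1 /=.
apply: ler_sum_nat => s /andP[_ sk].
rewrite !nested_limit_bits//; last exact: ltnW.
case: eqVneq => [_|ds]; first exact: h0.
have hs : 2 ^+ s <= `|height s.+1|.
  by apply: kernel_height_ge => // j; exact: limit_bits_le1.
apply: (@le_trans _ _ (4 * (2 ^- M * (2 ^+ s * 2 ^+ (M - s.+2))))); last first.
  by rewrite !ler_wpM2l// ?invr_ge0 ?exprn_ge0// ler_wpM2r// exprn_ge0.
rewrite -exprD (_ : 4 = 2 ^+ 2)//; last by rewrite expr2; lra.
rewrite mulrCA -exprD (_ : (2 + (s + (M - s.+2)) = M)%N); last by rewrite /M; lia.
by rewrite mulVf// expf_neq0.
Qed.

Hypothesis unbounded_n : forall C, exists k, (C <= walsh_variation (n_ k))%N.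

Let opposes M (i i' : {ffun 'I_M -> bool}) : bool :=
  [exists s : 'I_M, splits_at i i' s && (height s < 0)].

(** Here [d] holds the digits of an arbitrary point and [b i] those of the mass in cell [i]. One
    finite range of [k] serves all points, which later allows spikes of one fixed width. *)
Lemma discrete_hump (A : R) : exists M k0 K (b : {ffun 'I_M -> bool} -> nat -> bool),
  forall d : nat -> bool, exists2 k, (k < k0 + K)%N &
  A <= `|2 ^- M * \sum_i dirichlet_sign (n_ k)
            (fun j => bit_signs R d j * bit_signs R (b i) j)|.
Proof.
have [C AC] : exists C : nat, A <= C%:R.
  by exists (Num.truncn `|A|).+1; rewrite ltW// (le_lt_trans (ler_norm _))// truncnS_gt.
(* [walsh_variation_le] costs 2 and [sum_height_ge] costs a factor 4. *)
have [kM CkM] := unbounded_n (4 * C + 2).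
pose M := (top kM).+1.
pose T := {ffun 'I_M -> bool}.
pose rank (i : T) := nat_of_ord (enum_rank i).
have rank_inj : injective rank by move=> i i' /ord_inj/enum_rank_inj.
pose X : R := \sum_(s < M) `|height s| * 2 ^+ (M - s.+1).
have X_ge : A <= 2 ^- M * X.
  apply: le_trans AC _; rewrite -(@ler_pM2l _ 4)//.
  apply: le_trans (sum_height_ge kM); rewrite -(natrM _ 4) ler_nat.
  have n0 : (0 < n_ kM)%N by case: nested_n.
  by have := walsh_variation_le n0; rewrite -/(top kM); lia.
(* Index 2 * rank i aims at the points of cell i with all the other masses
   pulling upwards, index 2 * rank i + 1 with the other masses reversed. *)
pose t (i' : T) l := [exists i : T, [&& rank i == l./2, i' != i &
  opposes i i' (+) odd l]].
have tE i i' (c : bool) : t i' (c + (rank i).*2)%N = (i' != i) && (opposes i i' (+) c).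
  rewrite /t; apply/existsP/idP => [[i0 /and3P[]]|h].
    by rewrite half_bit_double oddD odd_double addbF oddb => /eqP/rank_inj->->->.
  by exists i; rewrite half_bit_double eqxx oddD odd_double addbF oddb.
pose ext (i : T) j := if insub j is Some j' then i j' else false.
have /choice[b bP] : forall i : T, exists b : nat -> bool,
    (forall j, (j < top M)%N -> b j = ext i j) /\
    forall l, (l < #|T|.*2)%N ->
      walsh_sign (n_ (M + l)) (bit_signs R b) = (-1) ^+ t i l.
  by move=> i; exact: exists_bits_walsh_sign.
(* Since [M <= top M], prescribing signs from index [M] on leaves intact the first [M] digits, which
   place the mass in its cell. Each cell gets two indices. *)
exists M, M, (#|T|.*2)%N, b => d.
pose i : T := [ffun j : 'I_M => d j].
pose a i' j := bit_signs R d j * bit_signs R (b i') j.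
have a2 i' j : a i' j ^+ 2 = 1 by rewrite /a exprMn !bit_signs_sqr mulr1.
have bE i' (s : 'I_M) : b i' s = i' s.
  rewrite (bP i').1; last by apply: leq_trans (nested_leq_max_spectrum nested_n M).
  by rewrite /ext valK.
have iE (s : 'I_M) : d s = i s by rewrite ffunE.
have lK (c : bool) : (c + (rank i).*2 < #|T|.*2)%N.
  have : (rank i < #|T|)%N := ltn_ord _.
  by move: (rank i) #|T| => p q; case: c; lia.
pose k (c : bool) := (M + (c + (rank i).*2))%N.
pose G c := walsh_sign (n_ (k c)) (a i) * dirichlet_sign (n_ (k c)) (a i).
have SE c : walsh_sign (n_ (k c)) (bit_signs R d) *
    (\sum_i' dirichlet_sign (n_ (k c)) (a i')) = (-1) ^+ c * X + G c.
  rewrite mulr_sumr (bigD1 i)//= addrC.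
  (* The Walsh sign of [d] is that of [a i'] times that of [b i'], because the latter squares to 1;
     and the latter is the prescribed sign. *)
  have term i' : walsh_sign (n_ (k c)) (bit_signs R d) * dirichlet_sign (n_ (k c)) (a i') =
      (-1) ^+ ((i' != i) && (opposes i i' (+) c)) *
      (walsh_sign (n_ (k c)) (a i') * dirichlet_sign (n_ (k c)) (a i')).
    rewrite -tE -(bP i').2// -/(k c) mulrA; congr (_ * _).
    rewrite [in RHS]walsh_signM mulrCA -expr2 walsh_sign_sqr ?mulr1//.
    by move=> j; exact: bit_signs_sqr.
  congr (_ + _); last by rewrite term eqxx mul1r.
  rewrite /X -(sum_splits_at i (fun s => `|height s|)) mulr_sumr.
  apply: eq_bigr => i' i'i; rewrite term i'i /= addbC signr_addb -mulrA.
  congr (_ * _); have [s ds] : exists s, splits_at i i' s.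
    by apply: splits_at_exists; rewrite eq_sym.
  rewrite (big_pred1 s) => [|s']; last first.
    by apply/idP/eqP => [/(splits_at_unique ds)//|->].
  have /andP[ns /forallP ls] := ds.
  have -> : opposes i i' = (height s < 0).
    rewrite /opposes; apply/existsP/idP => [[s' /andP[/(splits_at_unique ds)->]]|hs] //.
    by exists s; rewrite ds.
  rewrite (@nested_kernel_height R n_ nested_n _ s) -/(height s)//.
  - by rewrite [RHS]normrEsign ?num_real.
  - move=> j js; have jM : (j < M)%N by exact: ltn_trans js (ltn_ord s).
    move: (ls (Ordinal jM)); rewrite js /= => /eqP ij.
    rewrite /a /bit_signs -[j]/(val (Ordinal jM)) bE iE ij -expr2.
    exact: sqrr_sign.
  - rewrite /a /bit_signs bE iE; move: ns.
    by case: (i s) (i' s) => [] []// _; rewrite ?expr1 ?expr0 ?mulr1 ?mul1r.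
  - apply: leq_trans (nested_leq_max_spectrum nested_n (k c)).
    by apply: leq_trans (ltnW (ltn_ord s)) _; rewrite /k leq_addr.
have X0 : 0 <= X by apply: sumr_ge0 => s _; rewrite mulr_ge0// exprn_ge0.
suff [c hc] : exists c : bool, X <= `|(-1) ^+ c * X + G c|.
  exists (k c); first by rewrite /k ltn_add2l.
  apply: le_trans X_ge _; rewrite normrM ger0_norm ?invr_ge0 ?exprn_ge0//.
  rewrite ler_wpM2l ?invr_ge0 ?exprn_ge0//; apply: le_trans hc _.
  by rewrite -SE normrM walsh_sign_norm ?mul1r// => j; exact: bit_signs_sqr.
have kk : (k false <= k true)%N by rewrite /k; lia.
(* A nonnegative [G false] reinforces [X]; a negative one equals [G true], which then reinforces
   [- X]. *)
have [G0|G1] := nested_kernel_ge0_or_eq nested_n (a2 i) kk.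
  exists false; rewrite expr0 mul1r; apply: le_trans (ler_norm _).
  by rewrite lerDl.
have [G0|/ltW G0] := lerP 0 (G false).
  exists false; rewrite expr0 mul1r; apply: le_trans (ler_norm _).
  by rewrite lerDl.
exists true; rewrite /G G1 -/(G false) expr1 mulN1r ler_normr; apply/orP; right.
by rewrite opprD opprK lerDl oppr_ge0.
Qed.

End discrete_hump.

(** * Dyadic intervals and integrals of Walsh functions *)

Section Rintegral_finite_sums.
Context d (T : measurableType d) (R : realType).
Variable mu : {measure set T -> \bar R}.
Context (D : set T) (I : Type) (F : I -> T -> R).
Hypothesis mD : measurable D.
Hypothesis intF : forall i, mu.-integrable D (EFin \o F i).

Lemma integrable_sumr (s : seq I) : mu.-integrable D (EFin \o (fun x => \sum_(i <- s) F i x)).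
Proof.
apply: (eq_integrable _ (fun x => \sum_(i <- s) (F i x)%:E)%E) => //.
  by move=> x _ /=; rewrite sumEFin.
apply: integrable_sum => // i _; exact: intF.
Qed.

Lemma Rintegral_sum (s : seq I) :
  \int[mu]_(x in D) (\sum_(i <- s) F i x) = \sum_(i <- s) \int[mu]_(x in D) F i x.
Proof.
elim: s => [|i s IH].
  by under eq_Rintegral do rewrite big_nil; rewrite big_nil Rintegral_cst ?mul0r.
under eq_Rintegral do rewrite big_cons.
by rewrite RintegralD ?big_cons ?IH//; exact: integrable_sumr.
Qed.

End Rintegral_finite_sums.

Section walsh_measurability.
Variable R : realType.
Notation mu := (@lebesgue_measure R).
Implicit Types x : R.

Lemma rademacher_sqr j x : rademacher j x ^+ 2 = 1.
Proof.
rewrite /rademacher /rademacher0; case: ifP => _; first by rewrite expr1n.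
by rewrite sqrrN expr1n.
Qed.

Lemma walsh_norm k x : `|walsh k x| = 1.
Proof.
rewrite -[walsh k x]/(walsh_sign k (fun j => rademacher j x)) walsh_sign_norm// => j.
exact: rademacher_sqr.
Qed.

Lemma measurable_rademacher j : measurable_fun setT (@rademacher R j).
Proof.
have m0 : measurable_fun setT (@rademacher0 R).
  apply: measurable_fun_ifT => //; apply: measurable_fun_ltr => //.
  apply: measurable_funB => //; apply: nondecreasing_measurable => // x y xy.
  by rewrite ler_int le_floor.
apply: (measurableT_comp m0) => //; exact: measurable_funM.
Qed.

Lemma measurable_walsh k : measurable_fun setT (@walsh R k).
Proof.
apply: measurable_prod => j _; apply: measurable_funX; exact: measurable_rademacher.
Qed.

Lemma integrable_mul_walsh D (f : R -> R) k : measurable D ->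
  mu.-integrable D (EFin \o f) -> mu.-integrable D (EFin \o (fun x => f x * walsh k x)).
Proof.
move=> mD intf; have /integrableP[/measurable_EFinP mf _] := intf.
apply: le_integrable intf => //.
  apply/measurable_EFinP; apply: measurable_funM => //.
  by apply: measurable_funTS; exact: measurable_walsh.
by move=> x _ /=; rewrite lee_fin normrM walsh_norm mulr1.
Qed.

End walsh_measurability.

Section dyadic_cells.
Variable R : realType.
Notation mu := (@lebesgue_measure R).
Implicit Types (x : R) (b : nat -> bool).

Definition dyadic_left L b : R := \sum_(0 <= j < L) (b j)%:R / 2 ^+ j.+1.

Definition dyadic_cell L b : set R :=
  `[dyadic_left L b, dyadic_left L b + 2 ^- L[.

Lemma dyadic_cellP L b x :
  dyadic_cell L b x <-> dyadic_left L b <= x < dyadic_left L b + 2 ^- L.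
Proof. by rewrite /dyadic_cell /= in_itv. Qed.

Lemma measurable_dyadic_cell L b : measurable (dyadic_cell L b).
Proof. exact: measurable_itv. Qed.

Lemma mu_dyadic_cell L b : mu (dyadic_cell L b) = (2 ^- L)%:E.
Proof.
rewrite /dyadic_cell lebesgue_measure_itv/= lte_fin ltrDl invr_gt0 exprn_gt0//.
by rewrite -EFinB addrAC subrr add0r.
Qed.

Lemma dyadic_left_recl L b :
  dyadic_left L.+1 b = ((b 0%N)%:R + dyadic_left L (b \o S)) / 2.
Proof.
rewrite /dyadic_left big_nat_recl// expr1 mulrDl; congr (_ + _).
rewrite mulr_suml; apply: eq_bigr => j _ /=.
by rewrite [2 ^+ j.+2]exprSr invfM mulrA.
Qed.

Lemma dyadic_cell_recl L b x : dyadic_cell L.+1 b x ->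
  dyadic_cell L (b \o S) (2 * x - (b 0%N)%:R).
Proof.
move=> /dyadic_cellP; rewrite dyadic_left_recl exprSr invfM => /andP[h1 h2].
by apply/dyadic_cellP/andP; split; lra.
Qed.

Lemma dyadic_cell_sub01 L b : dyadic_cell L b `<=` `[0, 1[.
Proof.
elim: L b => [|L IH] b x.
  move/dyadic_cellP; rewrite /dyadic_left big_geq// expr0 invr1 add0r.
  by rewrite /= in_itv.
move=> /dyadic_cell_recl/IH; rewrite /= !in_itv/=.
by case: (b 0%N) => /=; rewrite ?mulr1n ?mulr0n => /andP[? ?]; apply/andP; split; lra.
Qed.

Lemma rademacher0D_nat x (m : nat) : rademacher0 (x + m%:R) = rademacher0 x.
Proof.
rewrite /rademacher0 floorDrz ?natr_int// intrD [(Num.floor m%:R)%:~R]floorK ?natr_int//.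
by rewrite opprD addrACA subrr addr0.
Qed.

(** The map sending [x] to [2 * x - b 0] shifts the digits, and [r_(j+1)] at [x] is [r_j] at the
    image, as the two arguments of [rademacher0] differ by an integer. *)
Lemma rademacher_dyadic_cell L b x j : dyadic_cell L b x -> (j < L)%N ->
  rademacher j x = bit_signs R b j.
Proof.
elim: L b x j => // L IH b x [|j] cx.
  move=> _; have := dyadic_cell_sub01 (dyadic_cell_recl cx).
  have := dyadic_cell_sub01 cx; rewrite /= !in_itv/= => /andP[x0 x1] /andP[y0 y1].
  rewrite /rademacher expr0 mul1r /rademacher0 /bit_signs.
  have -> : Num.floor x = 0 by apply: floor_def; rewrite add0r x0 x1.
  rewrite subr0; move: y0 y1; case: (b 0%N); rewrite /= ?mulr1n ?mulr0n => y0 y1.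
    by rewrite expr1 ifF//; apply/negbTE; rewrite -leNgt; lra.
  by rewrite expr0 ifT//; lra.
rewrite ltnS => jL; rewrite -[RHS](IH (b \o S) _ j (dyadic_cell_recl cx) jL).
rewrite /rademacher exprSr -mulrA.
have -> : 2 ^+ j * (2 * x) = 2 ^+ j * (2 * x - (b 0%N)%:R) + (2 ^ j * b 0%N)%:R.
  by rewrite natrM natrX; ring.
exact: rademacher0D_nat.
Qed.

Lemma walsh_dyadic_cell L b x k : dyadic_cell L b x -> (k < 2 ^ L)%N ->
  walsh k x = walsh_sign k (bit_signs R b).
Proof.
move=> cx kL; apply: (eq_walsh_sign kL) => j jL; exact: rademacher_dyadic_cell cx jL.
Qed.

Let set_bit b L c j := if j == L then c else b j.

Lemma dyadic_cell_split L b : dyadic_cell L b =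
  dyadic_cell L.+1 (set_bit b L false) `|` dyadic_cell L.+1 (set_bit b L true).
Proof.
have leftE c : dyadic_left L.+1 (set_bit b L c) = dyadic_left L b + c%:R / 2 ^+ L.+1.
  rewrite /dyadic_left big_nat_recr//= {2}/set_bit eqxx; congr (_ + _).
  by apply: eq_big_nat => j /andP[_ /ltn_eqF jL]; rewrite /set_bit jL.
have e : 2 ^- L = 2 ^- L.+1 + 2 ^- L.+1 :> R.
  by rewrite exprS invfM -mulrDl -[X in X * _](_ : 1 = _) ?mul1r//; field.
apply/seteqP; split=> x; rewrite /= /setU/= /dyadic_cell/= !in_itv/= !leftE/= mul0r addr0 mul1r e.
  case: (ltP x (dyadic_left L b + 2 ^- L.+1)) => h /andP[h1 h2]; [left|right].
    by rewrite h1.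
  by apply/andP; split=> //; rewrite -addrA.
have p : 0 < 2 ^- L.+1 :> R by rewrite invr_gt0 exprn_gt0.
by move=> [] /andP[h1 h2]; apply/andP; split; lra.
Qed.

Lemma dyadic_cell_disj L b :
  [disjoint dyadic_cell L.+1 (set_bit b L false) & dyadic_cell L.+1 (set_bit b L true)].
Proof.
apply/disj_setPS => x [/rademacher_dyadic_cell/(_ (ltnSn L)) h1].
move=> /rademacher_dyadic_cell/(_ (ltnSn L)); rewrite h1 /bit_signs /set_bit eqxx.
by rewrite expr0 expr1 => /eqP; rewrite -subr_eq0 opprK (_ : 1 + 1 = 2)// pnatr_eq0.
Qed.

Lemma integrable_walsh_cell L b k : mu.-integrable (dyadic_cell L b) (EFin \o walsh k).
Proof.
apply: measurable_bounded_integrable; first exact: measurable_dyadic_cell.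
- rewrite [X in (X < _)%E](_ : _ = (2 ^- L)%:E) ?ltry//; exact: mu_dyadic_cell.
- by apply: measurable_funTS; exact: measurable_walsh.
- by exists 1; split=> // t t1 x _ /=; rewrite walsh_norm ltW.
Qed.

Lemma Rintegral_walsh_cell_small L b k : (k < 2 ^ L)%N ->
  \int[mu]_(x in dyadic_cell L b) walsh k x = 2 ^- L * walsh_sign k (bit_signs R b).
Proof.
move=> kL.
transitivity (\int[mu]_(x in dyadic_cell L b) (walsh_sign k (bit_signs R b))).
  by apply: eq_Rintegral => x /set_mem cx; exact: walsh_dyadic_cell cx kL.
rewrite Rintegral_cst; last exact: measurable_dyadic_cell.
rewrite mulrC; congr (_ * _); rewrite -[RHS]/(fine (2 ^- L)%:E); congr fine.
exact: mu_dyadic_cell.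
Qed.

(** For [k >= 2 ^ L], halve the cell until its rank is [max_spectrum k]. The next halving yields two
    cells where the Walsh function is constant with opposite signs, so the integrals cancel. *)
Lemma Rintegral_walsh_cell L b k :
  \int[mu]_(x in dyadic_cell L b) walsh k x =
  if (k < 2 ^ L)%N then 2 ^- L * walsh_sign k (bit_signs R b) else 0.
Proof.
case: ltnP => [|Lk]; first exact: Rintegral_walsh_cell_small.
have k0 : (0 < k)%N by apply: leq_trans Lk; rewrite expn_gt0.
have Lt : (L <= max_spectrum k)%N by rewrite max_spectrumE// trunc_log_max.
have split_int L' b' : \int[mu]_(x in dyadic_cell L' b') walsh k x =
    \int[mu]_(x in dyadic_cell L'.+1 (set_bit b' L' false)) walsh k x +
    \int[mu]_(x in dyadic_cell L'.+1 (set_bit b' L' true)) walsh k x.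
  rewrite dyadic_cell_split Rintegral_setU//; try exact: measurable_dyadic_cell.
  - by rewrite -dyadic_cell_split; exact: integrable_walsh_cell.
  - exact: dyadic_cell_disj.
move: (subnK Lt); move: (max_spectrum k - L)%N => m; elim: m L b {Lk Lt} => [|m IH] L b e.
  rewrite add0n in e; rewrite split_int.
  have kL : (k < 2 ^ L.+1)%N by rewrite e; exact: ltn_max_spectrum.
  rewrite !Rintegral_walsh_cell_small// -mulrDr; apply/eqP; rewrite mulf_eq0; apply/orP; right.
  rewrite !(walsh_signE _ kL) !big_nat_recr//=.
  have -> : binary_coef L k = 1%N by rewrite e binary_coef_max_spectrum.
  have sL c : bit_signs R (set_bit b L c) L = (-1) ^+ c by rewrite /bit_signs /set_bit eqxx.
  rewrite !sL !expr1 expr0 mulr1 mulrN1 addr_eq0 opprK.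
  apply/eqP; apply: eq_big_nat => j /andP[_ /ltn_eqF jL].
  by rewrite /bit_signs /set_bit jL.
by rewrite split_int !IH ?addr0// addnS -addSn.
Qed.

End dyadic_cells.

(** * Spikes and the gliding hump *)

Section integrable_series.
Context d (T : measurableType d) (R : realType).
Variable mu : {measure set T -> \bar R}.
Context (D : set T) (F : nat -> T -> R) (C : R).
Hypothesis mD : measurable D.
Hypothesis F0 : forall i x, 0 <= F i x.
Hypothesis intF : forall i, mu.-integrable D (EFin \o F i).
Hypothesis sumF : forall N, \sum_(0 <= i < N) \int[mu]_(x in D) F i x <= C.

(** Monotone convergence makes the sum [g] of the series integrable, and [g] then dominates all
    partial sums weighted by [w]. The weights will be Walsh functions, so that Walsh coefficients
    pass to the limit. *)
Lemma integrable_series : exists f : T -> R, mu.-integrable D (EFin \o f) /\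
  forall w : T -> R, measurable_fun D w -> (forall x, `|w x| <= 1) ->
    \sum_(0 <= i < N) \int[mu]_(x in D) (F i x * w x) @[N --> \oo] -->
    \int[mu]_(x in D) (f x * w x).
Proof.
have mF i : measurable_fun D (F i).
  by have /integrableP[/measurable_EFinP] := intF i.
pose g x := (\sum_(i <oo) (F i x)%:E)%E.
have g0 x : (0 <= g x)%E by apply: nneseries_ge0 => i _ _; rewrite lee_fin.
have mg : measurable_fun D g.
  apply: (@ge0_emeasurable_sum _ _ _ D (fun i x => (F i x)%:E) xpredT) => i x.
    by move=> _; rewrite lee_fin.
  exact/measurable_EFinP.
have ig : mu.-integrable D g.
  apply/integrableP; split=> //.
  apply: (@le_lt_trans _ _ C%:E); last exact: ltry.
  under eq_integral => x _ do rewrite gee0_abs//.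
  rewrite integral_nneseries//; last 2 first.
  - by move=> i; exact/measurable_EFinP.
  - by move=> i x _; rewrite lee_fin.
  apply: lime_le.
    by apply: is_cvg_nneseries => i _ _; apply: integral_ge0 => x _; rewrite lee_fin.
  apply: nearW => N; apply: le_trans (_ : (\sum_(0 <= i < N) \int[mu]_(x in D) F i x)%:E <= _)%E.
    rewrite -sumEFin; apply: lee_sum => i _.
    by rewrite /Rintegral fineK//; exact: (integrable_fin_num mD (intF i)).
  by rewrite lee_fin.
have gfin := integrable_ae mD ig.
(* Where the series diverges, [fine] returns 0; this is a null set. *)
pose f := fine \o g.
have mf : measurable_fun D f by apply: measurableT_comp => //; exact: measurable_fine.
have Fw_cvg x (c : R) : g x \is a fin_num ->
    (\sum_(0 <= i < N) F i x * c)%:E @[N --> \oo] --> (f x * c)%:E.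
  move=> gx; apply: cvg_EFin; first exact: nearW.
  have -> : fine \o (fun N => (\sum_(0 <= i < N) F i x * c)%:E) =
      (fun N => \sum_(0 <= i < N) F i x * c) by [].
  under eq_fun do rewrite -mulr_suml.
  apply: cvgMl.
  have -> : (fun N => \sum_(0 <= i < N) F i x) =
      fine \o (fun N => \sum_(0 <= i < N) (F i x)%:E)%E.
    by apply/funext => N /=; rewrite sumEFin.
  apply: fine_cvg; rewrite fineK//.
  by apply: is_cvg_nneseries => i _ _; rewrite lee_fin.
have mFw (w : T -> R) i : measurable_fun D w -> measurable_fun D (fun x => F i x * w x).
  by move=> mw; exact: measurable_funM.
have ifw (w : T -> R) : measurable_fun D w -> (forall x, `|w x| <= 1) ->
    mu.-integrable D (fun x => (f x * w x)%:E) /\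
    (\int[mu]_(x in D) (\sum_(0 <= i < N) F i x * w x)%:E)%E @[N --> \oo] -->
    (\int[mu]_(x in D) (f x * w x)%:E)%E.
  move=> mw w1.
  have [] := @dominated_convergence _ _ _ mu D mD
    (fun N x => (\sum_(0 <= i < N) F i x * w x)%:E) (fun x => (f x * w x)%:E) g.
  - move=> N; apply/measurable_EFinP; apply: measurable_sum => i; exact: mFw.
  - by apply/measurable_EFinP; exact: measurable_funM.
  - by apply: filterS gfin => x gx Dx; exact: Fw_cvg (gx Dx).
  - exact: ig.
  - apply: aeW => x N _.
    apply: (@le_trans _ _ (\sum_(0 <= i < N) (F i x)%:E)%E).
      rewrite sumEFin /= lee_fin (le_trans (ler_norm_sum _ _ _))//.
      by apply: ler_sum => i _; rewrite normrM ger0_norm// ler_piMr.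
    by apply: nneseries_lim_ge => i _ _; rewrite lee_fin.
  - by move=> ? _ ?; split.
exists f; split.
  have [|x|] := ifw (cst 1); first exact: measurable_cst.
    by rewrite normr1.
  by move=> + _; apply: eq_integrable => // x _ /=; rewrite mulr1.
move=> w mw w1; have [ifw' cvgfw] := ifw w mw w1.
have iFw i : mu.-integrable D (EFin \o (fun x => F i x * w x)).
  apply: le_integrable (intF i) => //; first exact/measurable_EFinP/mFw.
  by move=> x _ /=; rewrite lee_fin normrM ler_piMr.
have -> : (fun N => \sum_(0 <= i < N) \int[mu]_(x in D) (F i x * w x)) =
    fine \o (fun N => \int[mu]_(x in D) (\sum_(0 <= i < N) F i x * w x)%:E)%E.
  by apply/funext => N; rewrite -(Rintegral_sum _ iFw).
apply: fine_cvg; rewrite fineK//; exact: integrable_fin_num.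
Qed.

End integrable_series.

Section spikes.
Variable R : realType.
Notation mu := (@lebesgue_measure R).
Context (T : finType) (b : T -> nat -> bool) (L : nat).

(** Each spike has width [2 ^- L] and mass [1 / #|T|]; it replaces the point mass with digits
    [b i]. *)
Definition spikes (x : R) : R :=
  \sum_(i <- index_enum T) 2 ^+ L / #|T|%:R * \1_(dyadic_cell L (b i)) x.

Lemma bump_ge0 x : 0 <= spikes x.
Proof. by apply: sumr_ge0 => i _; rewrite mulr_ge0// divr_ge0// exprn_ge0. Qed.

Let integrable_indic_cell i :
  mu.-integrable `[0, 1[ (EFin \o (fun x => 2 ^+ L / #|T|%:R * \1_(dyadic_cell L (b i)) x)).
Proof.
have int_setT : mu.-integrable setT (EFin \o \1_(dyadic_cell L (b i))).
  exact: integrable_indic_itv.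
have int01 : mu.-integrable `[0, 1[ (EFin \o \1_(dyadic_cell L (b i))).
  by apply: integrableS int_setT => //; exact: measurable_itv.
by apply: (integrableZl _ (2 ^+ L / #|T|%:R) int01); exact: measurable_itv.
Qed.

Lemma integrable_spikes : mu.-integrable `[0, 1[ (EFin \o spikes).
Proof. by apply: integrable_sumr; first exact: measurable_itv. Qed.

(** Below [2 ^ L] the Walsh functions are constant on each spike, so the coefficients are exactly
    those of the point masses; from [2 ^ L] on they integrate to 0 over each spike. *)
Lemma walsh_coef_spikes k : walsh_coef spikes k =
  if (k < 2 ^ L)%N then #|T|%:R^-1 * \sum_i walsh_sign k (bit_signs R (b i)) else 0.
Proof.
have m01 : measurable (`[0, 1[%classic : set R) by exact: measurable_itv.
rewrite /walsh_coef /spikes; under eq_Rintegral do rewrite mulr_suml.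
rewrite Rintegral_sum//; last by move=> i; exact: integrable_mul_walsh.
have cellE i : \int[mu]_(x in `[0, 1[)
    (2 ^+ L / #|T|%:R * \1_(dyadic_cell L (b i)) x * walsh k x) =
    2 ^+ L / #|T|%:R * \int[mu]_(x in dyadic_cell L (b i)) walsh k x.
  under eq_Rintegral do rewrite -mulrA.
  rewrite RintegralZl//; last first.
    apply: integrable_mul_walsh => //.
    apply: (integrableS measurableT) => //; exact: integrable_indic_itv.
  congr (_ * _); rewrite -[in RHS](setIidr (@dyadic_cell_sub01 R L (b i))).
  rewrite Rintegral_mkcondr; apply: eq_Rintegral => x _.
  by rewrite patchE indicE; case: ifP => _; rewrite ?mul1r ?mul0r.
under eq_bigr do rewrite cellE Rintegral_walsh_cell.
case: ifP => _; last by rewrite big1// => i _; rewrite mulr0.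
rewrite mulr_sumr; apply: eq_bigr => i _.
by rewrite [_ / _]mulrC -mulrA mulVKf// expf_neq0.
Qed.

Hypothesis T0 : (0 < #|T|)%N.

Lemma walsh_coef0_spikes : walsh_coef spikes 0 = 1.
Proof.
rewrite walsh_coef_spikes expn_gt0/= (eq_bigr (fun=> 1)) => [|i _]; last first.
  by rewrite /walsh_sign big_geq.
by rewrite sumr_const mulVf// pnatr_eq0 -lt0n.
Qed.

Lemma walsh_coef_spikes_le1 k : `|walsh_coef spikes k| <= 1.
Proof.
rewrite walsh_coef_spikes; case: ifP => _; last by rewrite normr0.
rewrite normrM ger0_norm ?invr_ge0// ler_pdivrMl ?ltr0n// mulr1.
apply: le_trans (ler_norm_sum _ _ _) _; rewrite -sum1_card natr_sum.
apply: ler_sum => i _; rewrite walsh_sign_norm// => j; exact: bit_signs_sqr.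
Qed.

Lemma walsh_partial_sum_spikes_le n x : `|walsh_partial_sum n spikes x| <= (2 ^ L)%:R.
Proof.
rewrite /walsh_partial_sum; apply: le_trans (ler_norm_sum _ _ _) _.
apply: (@le_trans _ _ (\sum_(0 <= k < n) (k < 2 ^ L)%N%:R)).
  apply: ler_sum => k _; rewrite normrM walsh_norm mulr1.
  have := walsh_coef_spikes_le1 k; rewrite walsh_coef_spikes.
  by case: ifP => _ //; rewrite normr0.
rewrite -natr_sum ler_nat; elim: n => [|n IH]; first by rewrite big_geq.
have le_n m : (\sum_(0 <= k < m) (k < 2 ^ L) <= m)%N.
  elim: m => [|m IHm]; first by rewrite big_geq.
  by rewrite big_nat_recr//=; case: (_ < _)%N; lia.
rewrite big_nat_recr//=; case: ltnP => [nL|_]; last by rewrite addn0.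
by rewrite addn1; apply: leq_ltn_trans (le_n n) nL.
Qed.

Lemma walsh_partial_sum_spikes n (x : R) (d : nat -> bool) : (n <= 2 ^ L)%N ->
  (forall j, rademacher j x = bit_signs R d j) ->
  walsh_partial_sum n spikes x =
  #|T|%:R^-1 * \sum_i dirichlet_sign n (fun j => bit_signs R d j * bit_signs R (b i) j).
Proof.
move=> nL xd; rewrite /walsh_partial_sum /dirichlet_sign exchange_big/= mulr_sumr.
apply: eq_big_nat => k /andP[_ kn]; rewrite walsh_coef_spikes (leq_trans kn nL) -mulrA.
congr (_ * _); rewrite mulr_suml; apply: eq_bigr => i _; rewrite walsh_signM mulrC.
congr (_ * _); apply: eq_bigr => j _; by rewrite xd.
Qed.

End spikes.

Section divergence.
Variable R : realType.
Notation mu := (@lebesgue_measure R).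

Lemma walsh_partial_sum_le (f : R -> R) n x : (forall k, `|walsh_coef f k| <= 1) ->
  `|walsh_partial_sum n f x| <= n%:R.
Proof.
move=> f1; apply: le_trans (ler_norm_sum _ _ _) _.
apply: (@le_trans _ _ (\sum_(0 <= k < n) 1)).
  by apply: ler_sum => k _; rewrite normrM walsh_norm mulr1.
by rewrite big_const_nat subn0 iter_addr addr0.
Qed.

Lemma exists_spikes (n_ : nat -> nat) (A : R) : nested_spectrums n_ ->
  (forall C, exists k, (C <= walsh_variation (n_ k))%N) ->
  exists (P : R -> R) (N : nat),
    [/\ forall x, 0 <= P x, mu.-integrable `[0, 1[ (EFin \o P), walsh_coef P 0 = 1,
        forall k, `|walsh_coef P k| <= 1 &
        forall x, (forall n, `|walsh_partial_sum n P x| <= N%:R) /\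
          exists2 k, (n_ k <= N)%N & A <= `|walsh_partial_sum (n_ k) P x|].
Proof.
move=> nested_n unb.
have [M [k0 [K [b hb]]]] := @discrete_hump R n_ nested_n unb A.
(* Spikes this narrow are indistinguishable from point masses for every [n_ k] with [k < k0 + K]. *)
pose L := (max_spectrum (n_ (k0 + K))).+1.
have n_le k : (k < k0 + K)%N -> (n_ k <= 2 ^ L)%N.
  move=> kK; have n0 : (0 < n_ k)%N by case: nested_n.
  apply: leq_trans (ltnW (ltn_max_spectrum n0)) _; rewrite leq_exp2l// ltnS.
  exact: ltnW (nested_max_spectrum_lt nested_n kK).
have cardT : #|{: {ffun 'I_M -> bool}}| = (2 ^ M)%N by rewrite card_ffun card_bool card_ord.
have T0 : (0 < #|{: {ffun 'I_M -> bool}}|)%N by rewrite cardT expn_gt0.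
exists (spikes b L), (2 ^ L)%N; split.
- exact: bump_ge0.
- exact: integrable_spikes.
- exact: walsh_coef0_spikes.
- exact: walsh_coef_spikes_le1.
move=> x; split=> [n|]; first exact: walsh_partial_sum_spikes_le.
pose d j := rademacher j x != 1.
have xd j : rademacher j x = bit_signs R d j.
  rewrite /bit_signs /d; case: eqVneq => [->//|x1] /=; rewrite expr1.
  by have /eqP := rademacher_sqr j x; rewrite sqrf_eq1 (negbTE x1) => /eqP.
have [k kK Ak] := hb d; exists k => //.
  exact: n_le.
by rewrite (walsh_partial_sum_spikes _ (n_le _ kK) xd) cardT natrX.
Qed.

(** [delta i] is chosen after the earlier [N (A j)], so that hump [i] is almost invisible to partial
    sums of those orders; [A i] is chosen after [delta i], so that hump [i] outweighs all earlier
    ones. *)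
Lemma gliding_hump (N : R -> nat) : exists (delta A : nat -> R),
  forall i, [/\ 0 < delta i, delta i <= 2 ^- i.+1,
    forall j, (j < i)%N -> delta i * (N (A j))%:R <= 2 ^- i.+1 &
    i%:R + 1 + \sum_(0 <= j < i) delta j * (N (A j))%:R <= delta i * A i].
Proof.
pose delta_of i (s : R * nat) : R := 2 ^- i.+1 / (1 + s.2)%:R.
pose A_of i s : R := (i%:R + 1 + s.1) / delta_of i s.
(* The state before step [i] holds the sum of [delta j * N (A j)] and the maximum of [N (A j)] over
   [j < i]. *)
pose state := fix state i : R * nat := if i is i'.+1 then
  let s := state i' in let n := N (A_of i' s) in
  (s.1 + delta_of i' s * n%:R, maxn s.2 n) else (0, 0%N).
pose delta i := delta_of i (state i); pose A i := A_of i (state i).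
have sum_state i : (state i).1 = \sum_(0 <= j < i) delta j * (N (A j))%:R.
  elim: i => [|i IH]; first by rewrite big_geq.
  by rewrite big_nat_recr//= IH.
have max_state i j : (j < i)%N -> (N (A j) <= (state i).2)%N.
  elim: i => // i IH; rewrite ltnS leq_eqVlt => /predU1P[->|/IH ji].
    by rewrite /= leq_max leqnn orbT.
  by rewrite /= leq_max ji.
have p2 i : 0 < 2 ^- i.+1 :> R by rewrite invr_gt0 exprn_gt0.
exists delta, A => i.
have d0 : 0 < delta i by rewrite divr_gt0 ?ltr0n.
split=> //.
- by rewrite ler_pdivrMr ?ltr0n// ler_peMr ?(ltW (p2 i))// ler1n.
- move=> j ji; rewrite /delta /delta_of mulrAC ler_pdivrMr ?ltr0n//.
  rewrite ler_pM2l// ler_nat; apply: leq_trans (max_state _ _ ji) _; exact: leqnSn.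
- by rewrite -sum_state /A /A_of -/(delta i) mulrCA divff ?mulr1// gt_eqF.
Qed.

Lemma sum_exp2V_le1 m n : \sum_(m <= i < n) 2 ^- i.+1 <= 1 :> R.
Proof.
have [nm|mn] := leqP n m; first by rewrite big_geq.
have tele : \sum_(m <= i < n) 2 ^- i.+1 = 2 ^- m - 2 ^- n :> R.
  rewrite -(subnKC (ltnW mn)); elim: (n - m)%N => [|p IH].
    by rewrite addn0 big_geq// subrr.
  rewrite addnS big_nat_recr ?leq_addr//= IH exprS invfM.
  by have : 2^-1 * 2 = 1 :> R; [rewrite mulVf|lra].
rewrite tele lerBlDr (le_trans (_ : _ <= 1)) ?lerDl ?invr_ge0 ?exprn_ge0//.
by rewrite invf_le1 ?exprn_gt0// exprn_ege1// ler1n.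
Qed.

End divergence.

(** * Divergence of the gliding hump at every point *)

Theorem theorem2p1 (R : realType) (n_ : nat -> nat)
  (hnested : nested_spectrums n_)
  (hunbounded :
    ereal_sup (range (fun k : nat => ((walsh_variation (n_ k))%:R : R)%:E))
      = +oo%E) :
  exists f : R -> R,
    (@lebesgue_measure R).-integrable `[0, 1[ (EFin \o f) /\
    (forall x : R, x \in `[0, 1[ ->
      ereal_sup (range (fun k : nat => `|walsh_partial_sum (n_ k) f x|%:E))
        = +oo%E).
Proof.
pose mu := @lebesgue_measure R.
have unb C : exists k, (C <= walsh_variation (n_ k))%N.
  have /ereal_sup_gt[_ [k _ <-]] : ((C%:R : R)%:E < ereal_sup (range
      (fun k : nat => ((walsh_variation (n_ k))%:R : R)%:E)))%E.
    by rewrite hunbounded ltry.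
  by rewrite lte_fin ltr_nat => /ltnW ?; exists k.
have /choice[P /choice[N PN]] := fun A => @exists_spikes R n_ A hnested unb.
have [delta [A dA]] := gliding_hump N.
have m01 : measurable (`[0, 1[%classic : set (measurableTypeR R)) by exact: measurable_itv.
have d0 i : 0 <= delta i by case: (dA i) => /ltW.
pose F i x := delta i * P (A i) x.
have intP i : mu.-integrable `[0, 1[ (EFin \o P (A i)) by case: (PN (A i)).
have coefF i k : \int[mu]_(x in `[0, 1[) (F i x * walsh k x) =
    delta i * walsh_coef (P (A i)) k.
  under eq_Rintegral do rewrite /F -mulrA.
  by rewrite RintegralZl//; exact: integrable_mul_walsh.
have F0 i x : 0 <= F i x by rewrite mulr_ge0//; case: (PN (A i)).
have intF i : mu.-integrable `[0, 1[ (EFin \o F i).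
  by apply: (integrableZl _ (delta i) (intP i)); exact: measurable_itv.
have sumF n : \sum_(0 <= i < n) \int[mu]_(x in `[0, 1[) F i x <= 1.
  apply: le_trans (sum_exp2V_le1 R 0 n); apply: ler_sum => i _.
  have -> : \int[mu]_(x in `[0, 1[) F i x = delta i.
    transitivity (\int[mu]_(x in `[0, 1[) (F i x * walsh 0 x)).
      by apply: eq_Rintegral => x _; rewrite /walsh big_geq ?mulr1.
    by rewrite coefF; case: (PN (A i)) => _ _ -> _ _; rewrite mulr1.
  by case: (dA i).
have [f [intf cvgf]] := integrable_series m01 F0 intF sumF.
exists f; split=> // x _; apply: eq_infty => t.
(* A partial sum of fixed order involves finitely many coefficients, and each of them converges by
   [cvgf]. *)
have cvgS n : \sum_(0 <= i < m) delta i * walsh_partial_sum n (P (A i)) x @[m --> \oo] -->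
    walsh_partial_sum n f x.
  have -> : (fun m => \sum_(0 <= i < m) delta i * walsh_partial_sum n (P (A i)) x) =
      (fun m => \sum_(0 <= k < n) (\sum_(0 <= i < m) delta i * walsh_coef (P (A i)) k) * walsh k x).
    apply/funext => m; under [RHS]eq_bigr do rewrite mulr_suml.
    rewrite exchange_big/=; apply: eq_bigr => i _; rewrite mulr_sumr.
    by apply: eq_bigr => k _; rewrite mulrA.
  apply: cvg_big => [|k _]; first exact: add_continuous.
  apply: cvgMl.
  have -> : (fun m => \sum_(0 <= i < m) delta i * walsh_coef (P (A i)) k) =
      (fun m => \sum_(0 <= i < m) \int[mu]_(x in `[0, 1[) (F i x * walsh k x)).
    by apply/funext => m; apply: eq_bigr => i _; rewrite coefF.
  apply: cvgf => [|y]; last by rewrite walsh_norm.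
  by apply: measurable_funTS; exact: measurable_walsh.
pose i := (Num.truncn `|t|).+1.
have ti : t <= i%:R by rewrite ltW// (le_lt_trans (ler_norm _))// truncnS_gt.
have [_ _ _ _ /(_ x)[_ [k kN Ak]]] := PN (A i).
apply: le_trans (_ : `|walsh_partial_sum (n_ k) f x|%:E <= _)%E; last first.
  by apply: ereal_sup_ubound; exists k.
rewrite lee_fin (le_trans ti)//.
apply: (@cvgr_to_ge _ _ _ _ _ _ _ (cvg_norm (cvgS (n_ k)))).
exists i.+1 => // m /= im.
(* Earlier humps [s1] obey their uniform bounds [N (A j)]. Later humps [s2] total at most 1, since
   [n_ k <= N (A i)] and their [delta j] were chosen against [N (A i)]. Hump [i] exceeds both bounds
   by [i]. *)
rewrite (@big_cat_nat _ _ _ i)//=; last exact: ltnW.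
set s1 := \sum_(0 <= j < i) _; rewrite big_ltn//; set s2 := \sum_(i.+1 <= j < m) _.
have h1 : `|s1| <= \sum_(0 <= j < i) delta j * (N (A j))%:R.
  apply: le_trans (ler_norm_sum _ _ _) _; apply: ler_sum => j _.
  rewrite normrM ger0_norm// ler_wpM2l//.
  by have [_ _ _ _ /(_ x)[+ _]] := PN (A j); apply.
have h2 : `|s2| <= 1.
  apply: le_trans (sum_exp2V_le1 R i.+1 m).
  apply: le_trans (ler_norm_sum _ _ _) _; apply: ler_sum_nat => j /andP[ij _].
  have [_ _ /(_ i ij) dj _] := dA j; apply: le_trans dj.
  rewrite normrM ger0_norm// ler_wpM2l//.
  apply: (@le_trans _ _ (n_ k)%:R); last by rewrite ler_nat.
  by apply: walsh_partial_sum_le; case: (PN (A j)).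
have h3 : i%:R + 1 + \sum_(0 <= j < i) delta j * (N (A j))%:R <=
    `|delta i * walsh_partial_sum (n_ k) (P (A i)) x|.
  have [_ _ _ di] := dA i; apply: le_trans di _.
  by rewrite normrM ger0_norm// ler_wpM2l.
set z := delta i * _ in h3 *.
have := ler_normB (s1 + (z + s2)) (s1 + s2).
rewrite (_ : s1 + (z + s2) - (s1 + s2) = z); last by ring.
have := ler_normD s1 s2; lra.
Qed.
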